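(* Let $r$ be a real number with $\frac12<r<\sqrt{2-\sqrt3}$. Let $C\subset\mathbb{R}^3$ be the solid cylinder $C=\{(x,y,z): x^2+y^2\le r^2,\ |z|\le r\}$ and let $K\subset\mathbb{R}^3$ be the solid double cone $K=\{(x,y,z): \sqrt{x^2+y^2}+|z|\le 1\}$. Then: (i) for every $\xi\in S^2$ there exists a rotation $\varphi_\xi\in SO(2,\xi^\perp)$ such that $\varphi_\xi(C\cap\xi^\perp)\subseteq K\cap\xi^\perp$; (ii) for every $\xi\in S^2$ there exists a rotation $\varphi_\xi\in SO(2,\xi^\perp)$ such that $\varphi_\xi(C|\xi^\perp)\subseteq K|\xi^\perp$; (iii) there is no $\psi\in SO(3)$ such that $\psi(C)\subseteq K$.
   Context: For a unit vector $\xi\in S^{2}$, $\xi^\perp=\{x\in\mathbb{R}^3: x\cdot\xi=0\}$. $C\cap\xi^\perp$ denotes the section of $C$ by $\xi^\perp$ and $C|\xi^\perp$ denotes the orthogonal projection of $C$ onto $\xi^\perp$ (similarly for $K$). $SO(2,\xi^\perp)$ is the group of rotations of the plane $\xi^\perp$ around the origin (equivalently, restrictions to $\xi^\perp$ of rotations $\Phi\in SO(3)$ with $\Phi(\xi)=\xi$). *)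

(* Defs.v *)
From HB Require Import structures.
From mathcomp Require Import all_boot all_order all_algebra.
From mathcomp Require Import classical_sets reals.
Set Implicit Arguments.
Unset Strict Implicit.
Unset Printing Implicit Defensive.
Import Order.TTheory GRing.Theory Num.Theory.
Local Open Scope ring_scope.
Local Open Scope classical_set_scope.

(* Points of R^3 are column vectors; the Euclidean structure is given by [dot],
   since the norm that MathComp-Analysis puts on matrices is the sup norm.
   The coordinates x, y, z of v are v 0 0, v 1 0, v 2 0. *)

Definition dot {R : realType} (u v : 'cV[R]_3) : R :=
  \sum_(i < 3) u i 0 * v i 0.

Definition S2 {R : realType} : set 'cV[R]_3 := [set xi | dot xi xi = 1].

Definition perp {R : realType} (xi : 'cV[R]_3) : set 'cV[R]_3 :=
  [set x | dot x xi = 0].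

(* Orthogonal projection of R^3 onto [perp xi]; the formula is the right one
   for a unit vector [xi]. *)
Definition proj {R : realType} (xi x : 'cV[R]_3) : 'cV[R]_3 :=
  x - dot x xi *: xi.

Definition SO3 {R : realType} : set 'M[R]_3 :=
  [set A | A^T *m A = 1%:M /\ \det A = 1].

(* A rotation of the plane [perp xi] is represented by the rotation of R^3
   fixing [xi] that restricts to it; it is only applied to subsets of
   [perp xi]. *)
Definition SO2perp {R : realType} (xi : 'cV[R]_3) : set 'M[R]_3 :=
  [set A | SO3 A /\ A *m xi = xi].

Definition cylinder {R : realType} (r : R) : set 'cV[R]_3 :=
  [set v | v 0 0 ^+ 2 + v 1 0 ^+ 2 <= r ^+ 2 /\ `|v 2 0| <= r].

Definition double_cone {R : realType} : set 'cV[R]_3 :=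
  [set v | Num.sqrt (v 0 0 ^+ 2 + v 1 0 ^+ 2) + `|v 2 0| <= 1].

(* Main.v *)
Require Import Defs.
From mathcomp Require Import all_boot all_order all_algebra.
From mathcomp Require Import classical_sets reals.
From mathcomp Require Import ring lra.

(* Let h and z be the horizontal norm and the height of a vector, N = h^2 + z^2
   and eta = 2 - sqrt 3, the root of eta^2 = 4 eta - 1. The vector lies in K as
   soon as N <= 1 and (z^2 - h^2)^2 >= 2 N - 1, so only points of the cylinder
   with N >= 1/2, close to a corner h = z = r, matter. With x = xi_z^2, a quarter
   turn of the plane xi^perp works when x >= 1/4; when x <= 1/4, turn a corner
   to the steepest line of the plane. In both cases the new point satisfies
   |z^2 - h^2| >= 3 N / 2 - 2 eta, which is enough. The constant eta comes from
   x = 1/4, where both rotations only just fit when r^2 = eta.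

   The support functions of C and K are r (h + z) and max (h, z), while their
   gauges are max (h, z) / r and h + z. Hence the inverse of the rotation found
   for sections works for shadows.

   Whatever the direction of its axis, a rotated copy of C has a point with
   h = z = r on one of its two rim circles, so that h + z = 2 r > 1. *)

Set Implicit Arguments.
Unset Strict Implicit.
Unset Printing Implicit Defensive.
Import Order.TTheory GRing.Theory Num.Theory.
Local Open Scope ring_scope.
Local Open Scope classical_set_scope.

(** * Real inequalities behind the rotations, the shadows and the rim points *)

Section Plane.
Variable R : realType.

(** With [N = h^2 + z^2], [4 h^2 z^2 = N^2 - (z^2 - h^2)^2 <= (1 - N)^2], so [2 h z <= 1 - N]. *)
Lemma addr_le1 (h z : R) : 0 <= h -> 0 <= z -> h ^+ 2 + z ^+ 2 <= 1 ->
  2 * (h ^+ 2 + z ^+ 2) - 1 <= (2 * z ^+ 2 - (h ^+ 2 + z ^+ 2)) ^+ 2 ->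
  h + z <= 1.
Proof.
move=> h0 z0 N1 D.
have hz0 : 0 <= h * z by rewrite mulr_ge0.
have : 2 * (h * z) <= 1 - (h ^+ 2 + z ^+ 2).
  rewrite -ler_sqr ?nnegrE; [|lra|lra].
  lra.
move=> le; have hz1 : (h + z) ^+ 2 <= 1 ^+ 2 by move: le; rewrite !expr2; lra.
by rewrite -ler_sqr ?nnegrE ?addr_ge0 ?ler01.
Qed.

Lemma two_minus_sqrt3_bounds : let eta : R := 2 - Num.sqrt 3 in
  [/\ eta ^+ 2 = 4 * eta - 1, 1/4 < eta & eta < 27/100].
Proof.
have s0 := @sqrtr_ge0 R 3.
have s2 : Num.sqrt 3 ^+ 2 = 3 :> R by rewrite sqr_sqrtr.
split.
- by rewrite sqrrB s2; ring.
- by rewrite ltrBrDr -ltrBrDl -ltr_sqr ?nnegrE ?s2 //; lra.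
- by rewrite ltrBlDr -ltrBlDl -ltr_sqr ?nnegrE ?s2 //; lra.
Qed.

(** Here [N - 2 A^2 = (2 x - 1) N + 2 B^2 >= (1 + 2 x) N - 2 eta], and [x >= 1/4] yields the factor
    [3/2]. *)
Lemma quarter_turn_gap (eta x N A B : R) : 1/4 <= x ->
  0 <= N -> A ^+ 2 + B ^+ 2 = (1 - x) * N -> N - B ^+ 2 <= eta ->
  3/2 * N - 2 * eta <= `|2 * A ^+ 2 - N|.
Proof.
move=> x4 N0 AB h; rewrite ler_normr; apply/orP; right.
have : 1/4 * N <= x * N by rewrite ler_wpM2r.
by move: AB; rewrite mulrBl; lra.
Qed.

(* The rotation used here brings a corner of the section of the cylinder to the
   steepest line of the plane. *)
Lemma corner_turn_gap (eta x m N A B : R) : eta < 27/100 ->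
  0 <= x <= 1/4 -> 0 <= m -> m ^+ 2 = 1 - 2 * x ->
  1/2 <= N -> A ^+ 2 + B ^+ 2 = (1 - x) * N ->
  B ^+ 2 <= eta -> N - B ^+ 2 <= eta ->
  3/2 * N - 2 * eta <= `|(m * A + B) ^+ 2 / (1 - x) - N|.
Proof.
move=> eta27 /andP[x0 x4] m0 m2 N2 AB zeta heta.
have x1 : 0 < 1 - x by lra.
pose p := `|A|; pose q := `|B|.
have p0 : 0 <= p by exact: normr_ge0.
have q0 : 0 <= q by exact: normr_ge0.
have p2 : p ^+ 2 = A ^+ 2 by rewrite /p real_normK ?num_real.
have q2 : q ^+ 2 = B ^+ 2 by rewrite /q real_normK ?num_real.
have DE : (m * A + B) ^+ 2 / (1 - x) - N = (2 * m * (A * B) - 2 * x * A ^+ 2) / (1 - x).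
  have -> : N = (A ^+ 2 + B ^+ 2) / (1 - x) by rewrite AB; field; lra.
  by field: m2; lra.
(* When [A B < 0] the numerator in [DE] is negative with a larger modulus, so [|A|] and [|B|] cover
   both signs. *)
have lower : (2 * m * (p * q) - 2 * x * p ^+ 2) / (1 - x)
             <= `|(m * A + B) ^+ 2 / (1 - x) - N|.
  rewrite DE normrM (@gtr0_norm _ (1 - x)^-1) ?invr_gt0 //.
  rewrite ler_wpM2r ?invr_ge0 ?(ltW x1) //.
  rewrite p2; apply: le_trans _ (lerB_dist _ _).
  rewrite !normrM -/p -/q (ger0_norm m0) (ger0_norm x0) ger0_norm //.
  rewrite -/p -p2 expr2; nra.
apply: le_trans lower.
(* At an exact corner [N = 2 B^2], hence [p = m q]; elsewhere [N - 2 B^2] controls the defect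
   [p - m q]. *)
have factor : (p - m * q) * (p + m * q) = (1 - x) * (N - 2 * B ^+ 2).
  have -> : (1 - x) * (N - 2 * B ^+ 2) = p ^+ 2 + q ^+ 2 - 2 * (1 - x) * q ^+ 2.
    by rewrite mulrBr -AB p2 q2; ring.
  by ring: m2.
have DE' : (2 * m * (p * q) - 2 * x * p ^+ 2) / (1 - x)
         = (1 - 2 * x) * N - (p - m * q) ^+ 2 / (1 - x).
  have -> : N = (p ^+ 2 + q ^+ 2) / (1 - x) by rewrite p2 q2 AB; field; lra.
  by field: m2; lra.
rewrite DE'.
(* [|N - 2 B^2| <= e], as [B^2] and [N - B^2] are at most [eta]. The target is [N/2 - e], and the
   loss [9 e^2] stays below [e]. *)
pose e := 2 * eta - N.
have e0 : 0 <= e by rewrite /e; lra.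
have e4 : e <= 4/100 by rewrite /e; lra.
have dev : (p - m * q) ^+ 2 <= (1 - x) * (9 * e ^+ 2).
  have mq : 1/9 <= (p + m * q) ^+ 2.
    have : 0 <= m * (p * q) by rewrite !mulr_ge0.
    have : 1/2 * (23/100) <= m ^+ 2 * q ^+ 2 by rewrite ler_pM //; lra.
    have := sqr_ge0 p.
    by rewrite sqrrD exprMn mulrCA -mulrnAr; lra.
  have : ((p - m * q) * (p + m * q)) ^+ 2 <= (1 - x) * e ^+ 2.
    rewrite factor exprMn; apply: ler_pM; rewrite ?sqr_ge0 //.
      by rewrite expr2 ler_piMr //; lra.
    rewrite -[leLHS]real_normK ?num_real // ler_sqr ?nnegrE // ler_norml /e.
    by apply/andP; split; lra.
  rewrite exprMn => prod_le.
  have := ler_wpM2l (sqr_ge0 (p - m * q)) mq; lra.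
have -> : (p - m * q) ^+ 2 / (1 - x) = (1 - x)^-1 * (p - m * q) ^+ 2 by rewrite mulrC.
have : (1 - x)^-1 * (p - m * q) ^+ 2 <= 9 * e ^+ 2 by rewrite ler_pdivrMl.
have : e ^+ 2 <= 4/100 * e by rewrite expr2 ler_wpM2r.
have : x * N <= 1/4 * N by rewrite ler_wpM2r //; lra.
rewrite mulrBl mul1r -(mulrA 2 x) /e; lra.
Qed.

(** The equation of [eta] gives [(3/2 N - 2 eta)^2 - (2 N - 1) = (2 eta - N) (2 + 3/2 eta - 9/4 N)],
    with both factors non-negative. *)
Lemma gap_sqr (eta N D : R) : eta ^+ 2 = 4 * eta - 1 -> eta < 27/100 ->
  1/2 <= N -> N <= 2 * eta -> 3/2 * N - 2 * eta <= `|D| -> 2 * N - 1 <= D ^+ 2.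
Proof.
move=> eta2 eta27 N2 Neta le.
have : (3/2 * N - 2 * eta) ^+ 2 <= D ^+ 2.
  by rewrite -[leRHS]real_normK ?num_real // ler_sqr ?nnegrE //; lra.
apply: le_trans.
have : 0 <= (2 * eta - N) ^+ 2 by exact: sqr_ge0.
have : (2 * eta - N) * eta <= (2 * eta - N) * (27/100) by rewrite ler_wpM2l; lra.
move: eta2; rewrite !expr2; lra.
Qed.

(** Separation in the plane whose normal has horizontal length [s] and height [c]: [a] and [b] are
    coordinates along the horizontal and the steepest directions, and [(a, q, z)] is a preimage in
    K. *)
Lemma double_cone_shadow (a b c s : R) : s ^+ 2 + c ^+ 2 = 1 -> 0 <= s ->
  (forall p q, a * p + b * q
     <= Num.max (Num.sqrt (p ^+ 2 + (c * q) ^+ 2)) (s * `|q|)) ->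
  exists q z, b = s * z - c * q /\ Num.sqrt (a ^+ 2 + q ^+ 2) + `|z| <= 1.
Proof.
move=> sc1 s0 supp.
have s2 : s ^+ 2 = 1 - c ^+ 2 by rewrite -sc1; ring.
(* The shadow is the convex hull of an ellipse and two apexes. Either the point
   lies in the cone spanned by the elliptical arcs, and the direction
   [(a, b / c ^+ 2)] normal to the ellipse decides, or it lies below a tangent
   line through an apex, whose normal is [(+- m, +- 1)]. *)
have [/andP[c0 ell]|kite] := boolP ((c != 0)
    && ((1 - 2 * c ^+ 2) * b ^+ 2 <= (c ^+ 2 * a) ^+ 2)).
  exists (- b / c), 0; split; first by field.
  rewrite normr0 addr0.
  have := supp a (b / c ^+ 2).
  have -> : c * (b / c ^+ 2) = b / c by field.
  have -> : a * a + b * (b / c ^+ 2) = a ^+ 2 + (b / c) ^+ 2 by field.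
  have -> : (- b / c) ^+ 2 = (b / c) ^+ 2 by field.
  set Q := a ^+ 2 + _ => QE.
  have Q0 : 0 <= Q by rewrite addr_ge0 ?sqr_ge0.
  have sQ : s * `|b / c ^+ 2| <= Num.sqrt Q.
    rewrite -ler_sqr ?nnegrE ?sqrtr_ge0 ?mulr_ge0 //.
    rewrite sqr_sqrtr // exprMn real_normK ?num_real // -subr_ge0.
    have -> : Q - s ^+ 2 * (b / c ^+ 2) ^+ 2
       = ((c ^+ 2 * a) ^+ 2 - (1 - 2 * c ^+ 2) * b ^+ 2) / (c ^+ 2) ^+ 2.
      by rewrite /Q; field: s2.
    by rewrite divr_ge0 ?subr_ge0 ?sqr_ge0.
  move: QE; rewrite (max_idPl sQ) -{1}(sqr_sqrtr Q0).
  have := sqrtr_ge0 Q; set y := Num.sqrt Q => y0 yy.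
  rewrite leNgt; apply/negP => y1; move: yy; rewrite expr2 ger_pMl; lra.
have {kite} [m2 kite] : 0 < 1 - 2 * c ^+ 2
    /\ (c ^+ 2 * a) ^+ 2 <= (1 - 2 * c ^+ 2) * b ^+ 2.
  move: kite; rewrite negb_and negbK -ltNge => /orP[/eqP->|lt].
    by rewrite expr0n /= mul0r expr0n /= mulr0 subr0 mul1r sqr_ge0 ltr01.
  split; last exact: ltW.
  rewrite ltNge; apply/negP => le0; move: lt; apply/negP; rewrite -leNgt.
  by apply: le_trans (sqr_ge0 _); rewrite mulr_le0_ge0 ?sqr_ge0.
pose m := Num.sqrt (1 - 2 * c ^+ 2).
have mE : m ^+ 2 = 1 - 2 * c ^+ 2 by rewrite sqr_sqrtr // ltW.
have m0 : 0 < m by rewrite sqrtr_gt0.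
have s1 : 0 < s.
  rewrite lt0r s0 andbT; apply/eqP => s_0; move: s2; rewrite s_0 expr0n /=; lra.
have cb : c ^+ 2 * `|a| <= m * `|b|.
  have c20 := mulr_ge0 (sqr_ge0 c) (normr_ge0 a).
  rewrite -ler_sqr ?nnegrE // ?(mulr_ge0 (ltW m0)) //.
  by rewrite exprMn [leRHS]exprMn !real_normK ?num_real // mE -exprMn.
have := supp (Num.sg a * m) (if 0 <= b then 1 else -1).
set t := (if _ then _ else _).
have [t2 tb] : `|t| = 1 /\ b * t = `|b|.
  rewrite /t; case: (leP 0 b) => b0; first by rewrite normr1 mulr1 ger0_norm.
  by rewrite normrN normr1 ltr0_norm // mulrN1.
have tt : t ^+ 2 = 1 by rewrite -(@real_normK _ t) ?num_real // t2 expr1n.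
have aE : a * Num.sg a = `|a| by rewrite normrEsg mulrC.
rewrite mulrA aE tb t2 mulr1 => le_s.
have {le_s}le_s : `|a| * m + `|b| <= s.
  apply: le_trans le_s _; rewrite ge_max lexx andbT.
  rewrite -ler_sqr ?nnegrE ?sqrtr_ge0 //.
  rewrite sqr_sqrtr ?addr_ge0 ?sqr_ge0 // !exprMn tt mE s2.
  have : Num.sg a ^+ 2 <= 1 by rewrite sqr_sg; case: (a != 0) => //=; rewrite ?ler01.
  move=> /ler_wpM2r => /(_ _ (ltW m2)); lra.
(* The preimage lies in the triangle spanned by the origin, the apex of height [t] and the circle
   point [(sg a * m, - t * c) / s], which projects to the point of tangency. *)
exists (- (t * c * `|a| / m)), (t * ((`|b| - c ^+ 2 * `|a| / m) / s)); split.
  have {1}-> : b = `|b| * t by rewrite -tb -mulrA -expr2 tt mulr1.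
  by field; lra.
have -> : a ^+ 2 + (- (t * c * `|a| / m)) ^+ 2 = (`|a| * s / m) ^+ 2.
  rewrite -(@real_normK _ a) ?num_real //.
  have -> : (- (t * c * `|a| / m)) ^+ 2 = t ^+ 2 * (c * `|a| / m) ^+ 2 by field; lra.
  by rewrite tt; field: mE s2; lra.
have m1 : 0 <= m^-1 by rewrite invr_ge0 ltW.
have k0 : 0 <= `|a| * s / m by rewrite !mulr_ge0.
have l0 : 0 <= (`|b| - c ^+ 2 * `|a| / m) / s.
  by rewrite divr_ge0 // subr_ge0 ler_pdivrMr // [leRHS]mulrC.
rewrite sqrtr_sqr (normrM t) t2 mul1r (ger0_norm k0) (ger0_norm l0).
have -> : `|a| * s / m + (`|b| - c ^+ 2 * `|a| / m) / s = (`|a| * m + `|b|) / s.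
  by field: mE s2; lra.
by rewrite ler_pdivrMr // mul1r.
Qed.

(* In the plane orthogonal to a unit vector of height [z], [x] stands for
   [z ^+ 2], [N] for the squared norm of a vector, [B] for its height and [A] for
   the height of its image under the quarter turn. *)
Lemma turn_gap (eta x : R) : eta < 27/100 -> 0 <= x <= 1 -> exists c s,
  c ^+ 2 + s ^+ 2 = 1 /\ forall N A B, 1/2 <= N ->
    A ^+ 2 + B ^+ 2 = (1 - x) * N -> B ^+ 2 <= eta -> N - B ^+ 2 <= eta ->
    3/2 * N - 2 * eta <= `|2 * (c * B + s * A) ^+ 2 - N|.
Proof.
move=> eta27 /andP[x0 x1]; have [x4|x4] := leP (1/4) x.
  exists 0, 1; rewrite expr0n expr1n add0r; split=> // N A B N2 AB _ h.
  by rewrite mul0r mul1r add0r; apply: quarter_turn_gap AB h => //; lra.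
pose m := Num.sqrt (1 - 2 * x).
have m0 : 0 <= m by exact: sqrtr_ge0.
have m2 : m ^+ 2 = 1 - 2 * x by rewrite sqr_sqrtr //; lra.
pose k := Num.sqrt (2 * (1 - x)).
have k2 : k ^+ 2 = 2 * (1 - x) by rewrite sqr_sqrtr //; lra.
have k0 : k != 0 by rewrite -sqrf_eq0 k2; lra.
(* At a corner [A = m B], so [(A, B)] is parallel to the unit vector [(m, 1) / k] and [c B + s A] is
   maximal. *)
exists k^-1, (m / k); split.
  have -> : k^-1 ^+ 2 + (m / k) ^+ 2 = (1 + m ^+ 2) / k ^+ 2 by field.
  by rewrite m2 k2; field; lra.
move=> N A B N2 AB z h.
have -> : 2 * (k^-1 * B + m / k * A) ^+ 2 = 2 * (m * A + B) ^+ 2 / k ^+ 2 by field.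
have -> : 2 * (m * A + B) ^+ 2 / k ^+ 2 = (m * A + B) ^+ 2 / (1 - x).
  by rewrite k2; field; lra.
by apply: (@corner_turn_gap eta x m N A B) => //; rewrite x0 ltW.
Qed.

Lemma dot_plane_le (r a b p q : R) : 0 <= r -> a ^+ 2 + b ^+ 2 <= r ^+ 2 ->
  a * p + b * q <= r * Num.sqrt (p ^+ 2 + q ^+ 2).
Proof.
move=> r0 ab; apply: le_trans (ler_norm _) _.
have pq0 : 0 <= p ^+ 2 + q ^+ 2 by rewrite addr_ge0 ?sqr_ge0.
rewrite -ler_sqr ?nnegrE ?mulr_ge0 ?sqrtr_ge0 //.
rewrite exprMn sqr_sqrtr // real_normK ?num_real //.
apply: le_trans (ler_wpM2r pq0 ab).
have := sqr_ge0 (a * q - b * p); rewrite -subr_ge0 => sq.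
rewrite -subr_ge0; apply: le_trans sq _.
by rewrite le_eqVlt; apply/orP; left; apply/eqP; ring.
Qed.

(** The value is attained because [(p, q)] has length [sqrt (1 - n^2) >= 1 - |n|]. *)
Lemma unit_vector_dot (p q n : R) : p ^+ 2 + q ^+ 2 + n ^+ 2 = 1 ->
  exists x y, x ^+ 2 + y ^+ 2 = 1 /\ p * x + q * y = 1 - `|n|.
Proof.
rewrite -(@real_normK _ n) ?num_real //.
have : 0 <= `|n| by exact: normr_ge0.
move: `|n| => l l0 pql.
have p2 := sqr_ge0 p; have q2 := sqr_ge0 q.
have [l1|l1] := eqVneq l 1.
  move: pql; rewrite l1 expr1n => pq.
  have p0 : p = 0 by apply/eqP; rewrite -sqrf_eq0; apply/eqP; lra.
  have q0 : q = 0 by apply/eqP; rewrite -sqrf_eq0; apply/eqP; lra.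
  by exists 1, 0; rewrite p0 q0; split; ring.
have l_lt1 : l < 1.
  by rewrite lt_neqAle l1 -ler_sqr ?nnegrE ?ler01 // expr1n; lra.
(* The component along [(p, q)] is fixed by the product; [b] weights the orthogonal one so that the
   vector is unit. *)
pose b := Num.sqrt (2 * l / ((1 - l) * (1 + l) ^+ 2)).
have b2 : b ^+ 2 = 2 * l / ((1 - l) * (1 + l) ^+ 2).
  by rewrite sqr_sqrtr // divr_ge0 ?mulr_ge0 ?sqr_ge0 //; lra.
have pq : p ^+ 2 = 1 - l ^+ 2 - q ^+ 2 by lra.
exists (p / (1 + l) - b * q), (q / (1 + l) + b * p); split.
  have -> : (p / (1 + l) - b * q) ^+ 2 + (q / (1 + l) + b * p) ^+ 2
       = (p ^+ 2 + q ^+ 2) * ((1 + l)^-1 ^+ 2 + b ^+ 2) by field; lra.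
  by rewrite pq b2; field; lra.
have -> : p * (p / (1 + l) - b * q) + q * (q / (1 + l) + b * p)
        = (p ^+ 2 + q ^+ 2) / (1 + l) by field; lra.
by rewrite pq; field; lra.
Qed.
End Plane.

(** * Coordinates in dimension three *)

Lemma I3P (P : 'I_3 -> Prop) : P 0 -> P 1 -> P 2 -> forall i, P i.
Proof.
move=> P0 P1 P2 [[|[|[|//]]] lti3].
- by rewrite (_ : Ordinal lti3 = 0) //; apply: val_inj.
- by rewrite (_ : Ordinal lti3 = 1) //; apply: val_inj.
- by rewrite (_ : Ordinal lti3 = 2) //; apply: val_inj.
Qed.

Lemma sum3E (R : nmodType) (F : 'I_3 -> R) : \sum_i F i = F 0 + F 1 + F 2.
Proof.
rewrite !big_ord_recl big_ord0 addr0 addrA.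
by congr (_ + F _ + F _); apply: val_inj.
Qed.

Lemma det3E (R : comNzRingType) (A : 'M[R]_3) :
  \det A = A 0 0 * (A 1 1 * A 2 2 - A 1 2 * A 2 1)
         - A 0 1 * (A 1 0 * A 2 2 - A 1 2 * A 2 0)
         + A 0 2 * (A 1 0 * A 2 1 - A 1 1 * A 2 0).
Proof.
rewrite (expand_det_row _ 0) sum3E /cofactor.
rewrite !(expand_det_row _ ord0) !big_ord_recl !big_ord0 /cofactor !det_mx11 !mxE.
have E i j : lift i j = inord (bump i j) :> 'I_3.
  apply: val_inj; rewrite /= inordK // /bump.
  by move: (ltn_ord j); case: (i <= j)%N => lt2; [exact: lt2 | exact: leqW lt2].
have i1 : inord 1 = 1 :> 'I_3 by apply: val_inj; rewrite /= inordK.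
have i0 : inord 0 = 0 :> 'I_3 by apply: val_inj; rewrite /= inordK.
have i2 : inord 2 = 2 :> 'I_3 by apply: val_inj; rewrite /= inordK.
rewrite !E /= /bump /= ?(addn0,add0n,addn1,add1n) ?(i0,i1,i2) /=.
ring.
Qed.

(** * Rotations, sections and shadows in space *)

Section Geometry.
Variable R : realType.
Implicit Types (u v w xi : 'cV[R]_3) (A : 'M[R]_3).

Lemma dotE u v : dot u v = u 0 0 * v 0 0 + u 1 0 * v 1 0 + u 2 0 * v 2 0.
Proof. exact: sum3E. Qed.

Lemma dotC u v : dot u v = dot v u.
Proof. by rewrite !dotE; ring. Qed.

Lemma dotBl u v w : dot (u - v) w = dot u w - dot v w.
Proof. by rewrite !dotE !mxE; ring. Qed.

Lemma dotZl c u v : dot (c *: u) v = c * dot u v.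
Proof. by rewrite !dotE !mxE; ring. Qed.

Lemma dot_mulmx u v A : dot (A *m u) v = dot u (A^T *m v).
Proof.
have dot_mx x y : dot x y = (x^T *m y) 0 0.
  by rewrite mxE; apply: eq_bigr => i _; rewrite mxE.
by rewrite !dot_mx trmx_mul mulmxA.
Qed.

(* Rodrigues' formula. *)
Definition rot xi (c s : R) : 'M[R]_3 :=
  \matrix_(i, j) (c *+ (i == j) + (1 - c) * (xi i 0 * xi j 0)
    + s * nth 0 (nth [::] [:: [:: 0; - xi 2 0; xi 1 0];
                              [:: xi 2 0; 0; - xi 0 0];
                              [:: - xi 1 0; xi 0 0; 0]] i) j).

Lemma rot_SO2perp xi c s : S2 xi -> c ^+ 2 + s ^+ 2 = 1 -> SO2perp xi (rot xi c s).
Proof.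
rewrite /S2 /= dotE => xi1 cs1.
have z2 : xi 2 0 ^+ 2 = 1 - xi 0 0 ^+ 2 - xi 1 0 ^+ 2 by rewrite -xi1; ring.
have s2 : s ^+ 2 = 1 - c ^+ 2 by rewrite -cs1; ring.
split; first split.
- apply/matrixP.
  by apply: I3P; apply: I3P; rewrite !mxE sum3E !mxE /=; ring: z2 s2.
- by rewrite det3E !mxE /=; ring: z2 s2.
- apply/matrixP => i j; rewrite ord1; move: i.
  by apply: I3P; rewrite !mxE sum3E !mxE /=; ring: z2 s2.
Qed.

Lemma rot_height xi c s w : perp xi w ->
  (rot xi c s *m w) 2 0 = c * w 2 0 + s * (xi 0 0 * w 1 0 - xi 1 0 * w 0 0).
Proof.
rewrite /perp /= dotE => xiw.
rewrite mxE sum3E !mxE /=.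
transitivity (c * w 2 0 + s * (xi 0 0 * w 1 0 - xi 1 0 * w 0 0)
    + (1 - c) * xi 2 0 * (w 0 0 * xi 0 0 + w 1 0 * xi 1 0 + w 2 0 * xi 2 0)).
  ring.
by rewrite xiw; ring.
Qed.

(** The steepest line of the plane has squared slope sine [1 - xi_z^2]; [w] and its quarter turn,
    the cross product of [xi] and [w], share it as sine and cosine. *)
Lemma perp_height xi w : S2 xi -> perp xi w ->
  (xi 0 0 * w 1 0 - xi 1 0 * w 0 0) ^+ 2 + w 2 0 ^+ 2
    = (1 - xi 2 0 ^+ 2) * dot w w.
Proof.
rewrite /S2 /perp /= !dotE => xi1 xiw.
have z2 : xi 2 0 ^+ 2 = 1 - xi 0 0 ^+ 2 - xi 1 0 ^+ 2 by rewrite -xi1; ring.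
have h : w 0 0 * xi 0 0 + w 1 0 * xi 1 0 = - (w 2 0 * xi 2 0) by lra.
transitivity ((xi 0 0 ^+ 2 + xi 1 0 ^+ 2) * (w 0 0 ^+ 2 + w 1 0 ^+ 2)
   - (w 0 0 * xi 0 0 + w 1 0 * xi 1 0) ^+ 2 + w 2 0 ^+ 2); first by ring.
by rewrite h; ring: z2.
Qed.

Lemma SO3_dot A u v : SO3 A -> dot (A *m u) (A *m v) = dot u v.
Proof. by move=> [AA _]; rewrite dot_mulmx mulmxA AA mul1mx. Qed.

Lemma SO2perp_trmx xi A : SO2perp xi A -> SO2perp xi A^T.
Proof.
move=> [[AA dA] Axi]; split; first split.
- by rewrite trmxK; apply: mulmx1C.
- by rewrite det_tr.
- by rewrite -{1}Axi mulmxA AA mul1mx.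
Qed.

Lemma SO2perp_perp xi A w : SO2perp xi A -> perp xi w -> perp xi (A *m w).
Proof. by move=> [AO Axi]; rewrite /perp /= -{2}Axi SO3_dot. Qed.

Lemma section_rotation r xi : 0 <= r -> r < Num.sqrt (2 - Num.sqrt 3) -> S2 xi ->
  exists phi, SO2perp xi phi /\
    forall w, perp xi w -> cylinder r w -> double_cone (phi *m w).
Proof.
move=> r0 r_lt xi1.
have [] := two_minus_sqrt3_bounds R; set eta : R := 2 - Num.sqrt 3 => eta2 eta25 eta27.
have r2 : r ^+ 2 <= eta.
  rewrite -(@sqr_sqrtr _ eta) ?ler_sqr ?nnegrE ?sqrtr_ge0 ?(ltW r_lt) //; lra.
have x01 : 0 <= xi 2 0 ^+ 2 <= 1.
  move: xi1; rewrite /S2 /= dotE -!expr2 sqr_ge0 /=.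
  have := sqr_ge0 (xi 0 0); have := sqr_ge0 (xi 1 0); lra.
have [c [s [cs gap]]] := turn_gap eta27 x01.
have phiP := rot_SO2perp xi1 cs.
exists (rot xi c s); split=> // w wxi [wh wz].
have z2 : w 2 0 ^+ 2 <= r ^+ 2.
  by rewrite -[leLHS]real_normK ?num_real // ler_sqr ?nnegrE.
have NE : dot w w = w 0 0 ^+ 2 + w 1 0 ^+ 2 + w 2 0 ^+ 2 by rewrite dotE -!expr2.
have := SO3_dot w w phiP.1; have := rot_height c s wxi.
set y := rot xi c s *m w => yz.
rewrite {1}dotE -!expr2 => yN; rewrite /double_cone /=.
set h2 := y 0 0 ^+ 2 + _ in yN *.
have h20 : 0 <= h2 by rewrite addr_ge0 ?sqr_ge0.
have zz : `|y 2 0| ^+ 2 = y 2 0 ^+ 2 by rewrite real_normK ?num_real.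
apply: addr_le1; rewrite ?sqrtr_ge0 // sqr_sqrtr // zz yN; first by lra.
have [N2|N2] := leP (1/2) (dot w w); last first.
  by apply: le_trans (sqr_ge0 _); lra.
apply: (gap_sqr eta2) => //; first lra.
rewrite yz; apply: gap => //; first exact: perp_height.
- exact: le_trans z2 r2.
- lra.
Qed.

(** If [k M = r] then [k w] lies in C, so the gauge [h + z] of K at [A w] is at most [1 / k]; the
    support function of C there is [r] times this gauge, hence at most [M]. *)
Lemma shadow_support r xi A v w : 0 < r -> SO2perp xi A ->
  (forall w, perp xi w -> cylinder r w -> double_cone (A *m w)) ->
  cylinder r v -> perp xi w ->
  dot v (A *m w) <= Num.max (Num.sqrt (w 0 0 ^+ 2 + w 1 0 ^+ 2)) `|w 2 0|.
Proof.
move=> r0 AP sec [vh vz] wxi; set h := Num.sqrt _; set M := Num.max _ _.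
have hM : h <= M by rewrite le_max lexx.
have zM : `|w 2 0| <= M by rewrite le_max lexx orbT.
have h0 : 0 <= h by exact: sqrtr_ge0.
have hE : h ^+ 2 = w 0 0 ^+ 2 + w 1 0 ^+ 2 by rewrite sqr_sqrtr // addr_ge0 ?sqr_ge0.
have := le_trans h0 hM; rewrite le_eqVlt => /predU1P[M0|M0].
  have w0 : w = 0.
    have h_0 : h = 0 by lra.
    have z_0 : `|w 2 0| = 0 by have := normr_ge0 (w 2 0); lra.
    move: hE; rewrite h_0 expr0n /= => hE.
    have p0 := sqr_ge0 (w 0 0); have q0 := sqr_ge0 (w 1 0).
    apply/matrixP => i j; rewrite ord1 mxE; move: i; apply: I3P; apply/eqP.
    - by rewrite -sqrf_eq0; apply/eqP; lra.
    - by rewrite -sqrf_eq0; apply/eqP; lra.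
    - by rewrite -normr_eq0 z_0.
  by rewrite w0 mulmx0 -M0 dotE !mxE !mulr0 !addr0.
have [k [k0 kM]] : exists k, 0 < k /\ k * M = r.
  by exists (r / M); rewrite divr_gt0 // divfK // gt_eqF.
have kwxi : perp xi (k *: w).
  move: wxi; rewrite /perp /= !dotE !mxE => wxi.
  transitivity (k * (w 0 0 * xi 0 0 + w 1 0 * xi 1 0 + w 2 0 * xi 2 0)); first by ring.
  by rewrite wxi mulr0.
have kwC : cylinder r (k *: w).
  rewrite /cylinder /= !mxE normrM (gtr0_norm k0) !exprMn -mulrDr -hE -exprMn -kM.
  by rewrite ler_sqr ?nnegrE ?mulr_ge0 ?(ltW k0) ?(ltW M0) // !ler_pM2l.
have := sec _ kwxi kwC; rewrite -scalemxAr; move: (A *m w) => y.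
rewrite /double_cone /= !mxE normrM (gtr0_norm k0) !exprMn -mulrDr sqrtrM ?sqr_ge0 //.
rewrite sqrtr_sqr (gtr0_norm k0) -mulrDr => kle.
apply: (@le_trans _ _ (r * (Num.sqrt (y 0 0 ^+ 2 + y 1 0 ^+ 2) + `|y 2 0|))).
  rewrite dotE mulrDr; apply: lerD; first exact: dot_plane_le (ltW r0) vh.
  by apply: le_trans (ler_norm _) _; rewrite normrM ler_wpM2r.
by rewrite -kM mulrAC ler_piMl // ltW.
Qed.

Lemma unit_polar xi : exists e1 e2 s,
  [/\ e1 ^+ 2 + e2 ^+ 2 = 1, 0 <= s, xi 0 0 = s * e1 & xi 1 0 = s * e2].
Proof.
pose s := Num.sqrt (xi 0 0 ^+ 2 + xi 1 0 ^+ 2).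
have p0 := sqr_ge0 (xi 0 0); have q0 := sqr_ge0 (xi 1 0).
have s2 : s ^+ 2 = xi 0 0 ^+ 2 + xi 1 0 ^+ 2 by rewrite sqr_sqrtr // addr_ge0.
have [s0|s0] := eqVneq s 0.
  move: s2; rewrite s0 expr0n /= => s2.
  (* Without a horizontal part any unit [(e1, e2)] serves. *)
  exists 1, 0, 0; split; rewrite ?mul0r ?expr1n ?expr0n ?addr0 //.
    by apply/eqP; rewrite -sqrf_eq0; apply/eqP; lra.
  by apply/eqP; rewrite -sqrf_eq0; apply/eqP; lra.
exists (xi 0 0 / s), (xi 1 0 / s), s; split; rewrite ?sqrtr_ge0 //.
- by rewrite !expr_div_n -mulrDl -s2 divff // sqrf_eq0.
- by field.
- by field.
Qed.

Definition vec3 (x y z : R) : 'cV[R]_3 := \col_i nth 0 [:: x; y; z] i.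

Lemma mem_shadow_double_cone xi p : S2 xi -> perp xi p ->
  (forall w, perp xi w ->
    dot p w <= Num.max (Num.sqrt (w 0 0 ^+ 2 + w 1 0 ^+ 2)) `|w 2 0|) ->
  (proj xi @` double_cone) p.
Proof.
have [e1 [e2 [s [e12 s0 x0 x1]]]] := unit_polar xi.
rewrite /S2 /perp /= !dotE x0 x1.
have [c x2] : exists c, xi 2 0 = c by exists (xi 2 0).
rewrite x2 => xi1 pxi supp.
have e22 : e2 ^+ 2 = 1 - e1 ^+ 2 by rewrite -e12; ring.
have sc1 : s ^+ 2 + c ^+ 2 = 1 by rewrite -xi1; ring: e22.
have c2 : c ^+ 2 = 1 - s ^+ 2 by rewrite -sc1; ring.
pose g := e1 * p 0 0 + e2 * p 1 0.
have sg : s * g = - (c * p 2 0).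
  by apply/eqP; rewrite -subr_eq0 opprK -pxi /g; apply/eqP; ring.
have bz : s * (s * p 2 0 - c * g) = p 2 0.
  have -> : s * (s * p 2 0 - c * g) = s ^+ 2 * p 2 0 - c * (s * g) by ring.
  by rewrite sg; ring: c2.
have bg : c * (s * p 2 0 - c * g) = - g.
  have -> : c * (s * p 2 0 - c * g) = s * (c * p 2 0) - c ^+ 2 * g by ring.
  have -> : c * p 2 0 = - (s * g) by rewrite sg opprK.
  by ring: c2.
have [t u|q [z [bE le1]]] := double_cone_shadow (a := e1 * p 1 0 - e2 * p 0 0)
    (b := s * p 2 0 - c * g) sc1 s0.
  (* [t] and [u] are coordinates in the orthonormal basis [(- e2, e1, 0)], [(- c e1, - c e2, s)] of
     the plane. *)
  have := supp (vec3 (- e2 * t - c * e1 * u) (e1 * t - c * e2 * u) (s * u)).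
  rewrite !dotE !mxE /= x0 x1 x2.
  have -> : (- e2 * t - c * e1 * u) * (s * e1) + (e1 * t - c * e2 * u) * (s * e2)
            + s * u * c = 0 by ring: e22.
  move=> /(_ erefl); rewrite normrM (ger0_norm s0).
  have -> : (- e2 * t - c * e1 * u) ^+ 2 + (e1 * t - c * e2 * u) ^+ 2
          = t ^+ 2 + (c * u) ^+ 2 by ring: e22.
  by congr (is_true (_ <= _)); rewrite /g; ring.
exists (vec3 (e1 * q - e2 * (e1 * p 1 0 - e2 * p 0 0))
             (e2 * q + e1 * (e1 * p 1 0 - e2 * p 0 0)) z).
  rewrite /double_cone /= !mxE /=; apply: le_trans le1.
  rewrite le_eqVlt; apply/orP; left; apply/eqP; congr (Num.sqrt _ + _).
  by ring: e22.
apply/matrixP => i j; rewrite ord1; move: i; rewrite /proj.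
set k := dot _ _.
have kE : k = s * q + c * z by rewrite /k dotE !mxE /= x0 x1 x2; ring: e22.
have qE : q - k * s = g by rewrite kE -[RHS]opprK -bg bE; ring: c2.
have zE : z - k * c = p 2 0 by rewrite kE -bz bE; ring: c2.
apply: I3P; rewrite !mxE /= ?x0 ?x1 ?x2 //.
- transitivity (e1 * (q - k * s) - e2 * (e1 * p 1 0 - e2 * p 0 0)); first by ring.
  by rewrite qE /g; ring: e22.
- transitivity (e2 * (q - k * s) + e1 * (e1 * p 1 0 - e2 * p 0 0)); first by ring.
  by rewrite qE /g; ring: e22.
Qed.

Lemma cylinder_not_in_cone r A : 1 / 2 < r -> SO3 A ->
  ~ mulmx A @` cylinder r `<=` double_cone.
Proof.
move=> r2 AO sub; have AA := mulmx1C AO.1.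
have row1 : A 2 0 ^+ 2 + A 2 1 ^+ 2 + A 2 2 ^+ 2 = 1.
  have := congr1 (fun B : 'M_3 => B 2 2) AA.
  by rewrite !mxE sum3E !mxE -!expr2 eqxx.
have [x [y [xy1 xyE]]] := unit_vector_dot row1.
pose t : R := if 0 <= A 2 2 then 1 else -1.
have [t1 tA] : t ^+ 2 = 1 /\ A 2 2 * t = `|A 2 2|.
  rewrite /t; case: (leP 0 (A 2 2)) => A0; first by rewrite expr1n mulr1 ger0_norm.
  by rewrite sqrrN expr1n ltr0_norm // mulrN1.
(* The image of this rim point has height [r (1 - |A 2 2|) + r |A 2 2| = r]. *)
pose v := vec3 (r * x) (r * y) (r * t).
have vC : cylinder r v.
  rewrite /cylinder /= !mxE /=; split.
    by rewrite !exprMn -mulrDr xy1 mulr1.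
  rewrite -ler_sqr ?nnegrE //; last lra.
  by rewrite real_normK ?num_real // exprMn t1 mulr1.
have yz : (A *m v) 2 0 = r.
  rewrite mxE sum3E !mxE /=.
  transitivity (r * ((A 2 0 * x + A 2 1 * y) + A 2 2 * t)); first by ring.
  by rewrite xyE tA; ring.
have vv : dot v v = r ^+ 2 + r ^+ 2.
  rewrite dotE !mxE /=.
  transitivity (r ^+ 2 * (x ^+ 2 + y ^+ 2) + r ^+ 2 * t ^+ 2); first by ring.
  by rewrite xy1 t1 !mulr1.
have := sub _ (ex_intro2 _ _ v vC erefl).
rewrite /double_cone /= yz.
have -> : (A *m v) 0 0 ^+ 2 + (A *m v) 1 0 ^+ 2 = r ^+ 2.
  by have := SO3_dot v v AO; rewrite vv dotE -!expr2 yz => /addIr.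
by rewrite sqrtr_sqr ger0_norm; lra.
Qed.

End Geometry.

Theorem mainTheorem1 (R : realType) (r : R)
    (hr1 : 1 / 2 < r) (hr2 : r < Num.sqrt (2 - Num.sqrt 3)) :
  let C : set 'cV[R]_3 := cylinder r in
  let K : set 'cV[R]_3 := double_cone in
  [/\ forall xi : 'cV[R]_3, S2 xi ->
        exists phi : 'M[R]_3, SO2perp xi phi /\
          mulmx phi @` (C `&` perp xi) `<=` K `&` perp xi,
      forall xi : 'cV[R]_3, S2 xi ->
        exists phi : 'M[R]_3, SO2perp xi phi /\
          mulmx phi @` (proj xi @` C) `<=` proj xi @` K
    & ~ exists psi : 'M[R]_3, SO3 psi /\ mulmx psi @` C `<=` K].
Proof.
have r0 : 0 < r by lra.
split=> [xi xi1|xi xi1|[psi [psiO sub]]].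
- have [phi [phiP sec]] := section_rotation (ltW r0) hr2 xi1.
  exists phi; split=> // _ [w [wC wxi] <-].
  by split; [exact: sec | exact: SO2perp_perp].
- have [phi [phiP sec]] := section_rotation (ltW r0) hr2 xi1.
  exists phi^T; split; first exact: SO2perp_trmx.
  move=> _ [_ [v vC <-] <-].
  have vxi : perp xi (proj xi v).
    by rewrite /perp /proj /= dotBl dotZl (xi1 : dot xi xi = 1) mulr1 subrr.
  apply: mem_shadow_double_cone => //.
    exact: SO2perp_perp (SO2perp_trmx phiP) vxi.
  move=> w wxi; rewrite dot_mulmx trmxK /proj dotBl dotZl.
  have -> : dot xi (phi *m w) = 0.
    by rewrite -[xi in dot xi _](phiP.2) (SO3_dot _ _ phiP.1) dotC.
  by rewrite mulr0 subr0; exact: (shadow_support r0 phiP sec vC wxi).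
- exact: cylinder_not_in_cone hr1 psiO sub.
Qed.
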